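(* Let $d\ge 1$ and let $(X_{\mathbf n})_{\mathbf n\in\mathbb{Z}^d}$ be a translation-invariant process of real-valued random variables. Then almost surely $$\limsup_{\|\mathbf n\|\to\infty}\frac{X_{\mathbf n}}{\|\mathbf n\|}\in\{0,+\infty\}.$$
   Context: Translation-invariant means that for every $\mathbf u\in\mathbb{Z}^d$ the process $(X_{\mathbf n+\mathbf u})_{\mathbf n\in\mathbb{Z}^d}$ has the same law as $(X_{\mathbf n})_{\mathbf n\in\mathbb{Z}^d}$. Here $\|\cdot\|$ is any fixed norm on $\mathbb{R}^d$. *)

(* Defs.v *)
From HB Require Import structures.
From mathcomp Require Import all_boot all_order all_algebra.
From mathcomp Require Import all_classical all_reals all_analysis.

Set Implicit Arguments.
Unset Strict Implicit.
Unset Printing Implicit Defensive.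

Import Order.TTheory GRing.Theory Num.Theory.
Import numFieldNormedType.Exports.

Local Open Scope classical_set_scope.
Local Open Scope ring_scope.

Section process_law.
Context (I : Type) d (E : measurableType d).

Definition cylinders : set_system (I -> E) :=
  \bigcup_(i in [set: I])
    preimage_set_system setT (fun x : I -> E => x i) measurable.

(* E^I with the product sigma-algebra (I may be infinite) *)
Definition path_space := g_sigma_algebraType cylinders.

Context d0 (T : measurableType d0) (R : realType) (P : probability T R).

Definition trajectory (X : I -> {RV P >-> E}) (w : T) : path_space :=
  fun i => X i w.

Lemma measurable_trajectory (X : I -> {RV P >-> E}) :
  measurable_fun [set: T] (trajectory X).
Proof.
apply: (@measurability _ _ _ path_space setT (trajectory X) cylinders) => //.
move=> _ [_ [i _ [B mB <-]] <-].
have := measurable_funPT (X i) measurableT _ mB.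
by rewrite !setTI.
Qed.

HB.instance Definition _ (X : I -> {RV P >-> E}) :=
  isMeasurableFun.Build _ _ T path_space (trajectory X)
    (measurable_trajectory X).

Definition law (X : I -> {RV P >-> E}) : set path_space -> \bar R :=
  distribution P (trajectory X).

(* Laws are compared as measures, i.e. on measurable sets only. *)
Definition same_law (X Y : I -> {RV P >-> E}) :=
  forall A : set path_space, measurable A -> law X A = law Y A.

End process_law.

Definition translation_invariant (m : nat) d0 (T : measurableType d0)
    (R : realType) (P : probability T R) (X : 'rV[int]_m -> {RV P >-> R}) :=
  forall u : 'rV[int]_m, same_law (fun n => X (n + u)) X.

Record is_norm (R : numDomainType) (V : lmodType R) (N : V -> R) : Prop := {
  is_norm_triangle : forall x y, N (x + y) <= N x + N y ;
  is_norm_scale : forall (a : R) x, N (a *: x) = `|a| * N x ;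
  is_norm_eq0 : forall x, N x = 0 -> x = 0 }.

Definition lattice_norm (R : realType) (m : nat) (N : 'rV[R]_m -> R)
    (n : 'rV[int]_m) : R :=
  N (map_mx intr n).

(* the filter of "||n|| --> oo" on Z^m *)
Definition norm_to_infty (R : realType) (m : nat) (N : 'rV[R]_m -> R) :
    set_system 'rV[int]_m :=
  filter_from [set: R] (fun r => [set n | r < lattice_norm N n]).

(* limsup_{||n|| --> oo} f n: limf_esup f (norm_to_infty N) with limf_esup
   unfolded, because limf_esup requires a filteredType and Z^m is not one. *)
Definition limsup_norm (R : realType) (m : nat) (N : 'rV[R]_m -> R)
    (f : 'rV[int]_m -> \bar R) : \bar R :=
  ereal_inf [set ereal_sup (f @` V) | V in norm_to_infty N].

(* Main.v *)
(* Proof idea.  As [X n] has the law of [X 0], [X n / N n] tends to [0] in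
   probability, so the limsup is almost surely nonnegative.  Suppose that it lies
   in ]0, +oo[, and put rho n = [X n / beta] (integer part).  For suitable
   constants beta and K, every lattice point lies in cubes of centre n and radius
   K * rho n with rho n arbitrarily large, but in cubes of centre n and radius
   rho n only with rho n bounded.  This "critical" event is translation-invariant.
   On it, a Vitali selection bounds the number of points of a window covered by
   a large cube with L0 <= rho n <= L1 by a constant, depending only on K and d,
   times the number of points of a slightly bigger window covered by a small
   cube with L0 <= rho n.  Taking expectations, stationarity gives
     P(critical, 0 in a large cube with L0 <= rho n <= L1)
       <= C P(critical, 0 in a small cube with L0 <= rho n).
   As L1 -> oo the left-hand side tends to P(critical); then, as L0 -> oo, the
   right-hand side tends to 0. *)
Require Import Defs.
From mathcomp Require Import all_boot all_order all_algebra.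
From mathcomp Require Import all_classical all_reals all_analysis.
From mathcomp Require Import measurable_realfun zify lra.

Set Implicit Arguments.
Unset Strict Implicit.
Unset Printing Implicit Defensive.

Import Order.TTheory GRing.Theory Num.Theory.
Import numFieldNormedType.Exports.

Local Open Scope classical_set_scope.
Local Open Scope ring_scope.

(** * Sup norm, cubes and Vitali selection in [Z^d] *)

Section lattice.
Variable d : nat.
Implicit Types u v : 'rV[int]_d.

Definition supn v : nat := \max_(i < d) `|v 0%R i|%N.

Lemma supn_leP v (r : nat) : reflect (forall i, (`|v 0%R i| <= r)%N) (supn v <= r)%N.
Proof. by apply: (iffP (bigmax_leqP _ _ _)) => [h i|h i _]; [apply: h|]. Qed.

Lemma supn_coord v i : (`|v 0%R i| <= supn v)%N.
Proof. exact/supn_leP. Qed.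

Lemma supnD u v : (supn (u + v) <= supn u + supn v)%N.
Proof.
apply/supn_leP => i; rewrite mxE.
have abszD (a b : int) : (`|(a + b)%R| <= `|a| + `|b|)%N by lia.
by rewrite (leq_trans (abszD _ _))// leq_add// supn_coord.
Qed.

Lemma supnN v : supn (- v) = supn v.
Proof. by apply: eq_bigr => i _; rewrite mxE abszN. Qed.

Lemma supnB u v : supn (u - v) = supn (v - u).
Proof. by rewrite -supnN opprB. Qed.

Definition cube (r : nat) : seq 'rV[int]_d :=
  [seq \row_i ((f i : nat)%:Z - r%:Z) | f : {ffun 'I_d -> 'I_(r.*2.+1)}].

Lemma size_cube r : size (cube r) = (r.*2.+1 ^ d)%N.
Proof. by rewrite size_map -cardE card_ffun !card_ord. Qed.

Lemma cube_uniq r : uniq (cube r).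
Proof.
rewrite map_inj_uniq ?enum_uniq // => f g /rowP fg.
by apply/ffunP => i; apply/val_inj; have := fg i; rewrite !mxE /=; lia.
Qed.

Lemma mem_cube r v : (v \in cube r) = (supn v <= r)%N.
Proof.
apply/mapP/supn_leP => [[f _ -> i]|h].
  rewrite mxE; have := ltn_ord (f i); move: (nat_of_ord _) => k; lia.
exists [ffun i => inord (absz (v 0 i + r%:Z))]; rewrite ?mem_enum//.
apply/rowP => i; rewrite !mxE ffunE; have := h i; move: (v 0%R i) => z hz.
by rewrite inordK; lia.
Qed.

(* Vitali's selection, run as an induction on the list of centres: choose the
   largest radius, discard the centres whose small cube meets the chosen one,
   and recurse. *)
Lemma vitali_count (K : nat) (rho : 'rV[int]_d -> nat) (s w v : seq 'rV[int]_d) :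
  uniq w ->
  (forall m : 'rV[int]_d, m \in w ->
    exists2 n : 'rV[int]_d, n \in s & (supn (n - m) <= K * rho n)%N) ->
  (forall n m : 'rV[int]_d, n \in s -> (supn (n - m) <= rho n)%N -> m \in v) ->
  (size w <= (K.+2 ^ d) * size v)%N.
Proof.
have [k] := ubnP (size s); elim: k s w v => // k IHk s w v ssz uw hw hv.
case: s ssz hw hv => [|n0 s0] ssz hw hv.
  by case: w uw hw => // m w _ /(_ m (mem_head _ _))[].
have [n1 n1s n1max] : exists2 n1 : 'rV[int]_d, n1 \in n0 :: s0 &
    forall n : 'rV[int]_d, n \in n0 :: s0 -> (rho n <= rho n1)%N.
  elim: s0 {ssz hw hv} => [|n2 s1 [n1 n1s IH]].
    by exists n0; rewrite ?mem_head// => n; rewrite inE => /eqP->.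
  have [le12|lt21] := leqP (rho n2) (rho n1).
    exists n1 => [|n].
      by move: n1s; rewrite !inE => /orP[->|->]//; rewrite !orbT.
    rewrite !inE => /or3P[/eqP->|/eqP->//|ns]; apply: IH; rewrite ?mem_head//.
    by rewrite inE ns orbT.
  exists n2 => [|n]; first by rewrite !inE eqxx orbT.
  rewrite !inE => /or3P[/eqP->|/eqP->//|ns]; apply: leq_trans (ltnW lt21); apply: IH.
    by rewrite mem_head.
  by rewrite inE ns orbT.
move: (n0 :: s0) ssz hw hv n1s n1max => s ssz hw hv n1s n1max.
(* A discarded centre [n] has [supn (n - n1) <= rho n + rho n1]. With [rho n <= rho n1], a point at
   distance at most [K * rho n] from it is within [(K + 2) * rho n1] of [n1]: this is where [K.+2]
   comes from. *)
pose bigP := [pred m : 'rV[int]_d | (supn (n1 - m) <= K.+2 * rho n1)%N].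
pose smallP := [pred m : 'rV[int]_d | (supn (n1 - m) <= rho n1)%N].
pose s' := [seq n <- s | (rho n + rho n1 < supn (n - n1))%N].
have IH : (size (seq.filter (predC bigP) w) <=
    K.+2 ^ d * size (seq.filter (predC smallP) v))%N.
  apply: (IHk s').
  - rewrite size_filter -ltnS; apply: leq_trans ssz; rewrite ltnS.
    (* The list gets strictly shorter because [n1] is itself discarded. *)
    rewrite -(count_predC (fun n => (rho n + rho n1 < supn (n - n1))%N) s).
    rewrite -addn1 leq_add2l -has_count; apply/hasP; exists n1 => //=.
    by rewrite -leqNgt subrr; apply/supn_leP => i; rewrite mxE absz0.
  - exact: filter_uniq.
  - move=> m; rewrite mem_filter /= => /andP[mbig mw].
    have [n ns nm] := hw _ mw; exists n => //; rewrite mem_filter ns andbT ltnNge.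
    apply: contra mbig => nn1; rewrite -(subrKA n) (leq_trans (supnD _ _))//.
    rewrite supnB (leq_trans (leq_add nn1 nm))//.
    have := leq_mul (leqnn K) (n1max _ ns).
    have := n1max _ ns.
    rewrite !mulSn; lia.
  (* The small cube of a kept centre is disjoint from that of [n1], so removing the latter from [v]
     costs it no point. *)
  - move=> n m; rewrite !mem_filter => /andP[nn1 ns] nm.
    rewrite (hv _ _ ns nm) andbT /=.
    rewrite -ltnNge -(ltn_add2l (rho n)) (leq_trans nn1)//.
    rewrite -(subrKA m) (leq_trans (supnD _ _))// (supnB m) leq_add2r//.
rewrite -(count_predC bigP w) -(count_predC smallP v) mulnDr.
rewrite -!(size_filter (predC _)).
apply: leq_add => //.
(* The removed part of [w] fits in a cube of radius [(K + 2) * rho n1], while the removed part of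
   [v] contains the whole small cube of [n1]; the two volumes differ by a factor at most
   [(K + 2)^d]. *)
apply: (@leq_trans (size (cube (K.+2 * rho n1)))).
  rewrite -size_filter -(size_map (fun m => n1 - m)); apply: uniq_leq_size.
    rewrite map_inj_uniq ?filter_uniq// => x y /addrI/oppr_inj//.
  by move=> _ /mapP[m + ->]; rewrite mem_filter mem_cube => /andP[].
apply: (@leq_trans (K.+2 ^ d * size (cube (rho n1)))).
  by rewrite !size_cube -expnMn; case: (d) => // d'; rewrite leq_exp2r //; nia.
rewrite leq_mul2l; apply/orP; right.
rewrite -size_filter -(size_map (fun m => n1 - m) (cube _)); apply: uniq_leq_size.
  by rewrite map_inj_uniq ?cube_uniq// => x y /addrI/oppr_inj.
move=> _ /mapP[m + ->]; rewrite mem_filter mem_cube => mr /=.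
have e : n1 - (n1 - m) = m by rewrite opprB addrC subrK.
by rewrite e mr; apply: (hv n1) => //; rewrite e.
Qed.

End lattice.

(** * Measurability of countable quantifiers and of coordinate events *)

Lemma measurable_exists disp (T : measurableType disp) (J : countType)
    (B : J -> set T) :
  (forall j, measurable (B j)) -> measurable [set x | exists j, B j x].
Proof.
move=> mB; rewrite (_ : mkset _ = \bigcup_j B j).
  by apply: countable_bigcupT_measurable => //; exact: countableP.
by apply/seteqP; split => [x [j Bx]|x [j _ Bx]]; exists j.
Qed.

Lemma measurable_forall disp (T : measurableType disp) (J : countType)
    (B : J -> set T) :
  (forall j, measurable (B j)) -> measurable [set x | forall j, B j x].
Proof.
move=> mB; rewrite -[mkset _]setCK; apply: measurableC.
rewrite (_ : ~` _ = [set x | exists j, (~` B j) x]).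
  by apply: measurable_exists => j; exact: measurableC.
by apply/seteqP; split => x /= => [/existsNP|?]; [|apply/existsNP].
Qed.

Lemma measurable_coord (I : Type) disp (E : measurableType disp) (i : I)
    (B : set E) :
  measurable B -> measurable [set x : path_space I E | B (x i)].
Proof.
move=> mB; apply: sub_sigma_algebra; exists i => //.
by exists B => //; rewrite setTI.
Qed.

(** * From counting in windows to probabilities, by stationarity *)

Section stationary_field.
Context (d : nat) disp (T : measurableType disp) (R : realType).
Context (P : probability T R).
Context dE (E : measurableType dE) (X : 'rV[int]_d -> {RV P >-> E}).
Hypothesis stationary :
  forall u : 'rV[int]_d, same_law (fun n : 'rV[int]_d => X (n + u)) X.
Local Notation path := (path_space 'rV[int]_d E).

Definition translate (m : 'rV[int]_d) (x : path) : path := fun n => x (n + m).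

(** Phrased through the shifted family, so that [stationary] applies directly; it is convertible to
    the event that [translate m (trajectory X w)] lies in [B]. *)
Let shifted (B : set path) (m : 'rV[int]_d) : set T :=
  trajectory (fun n : 'rV[int]_d => X (n + m)) @^-1` B.

Let mshifted B m : measurable B -> measurable (shifted B m).
Proof.
by move=> mB; rewrite -[shifted B m]setTI; exact: measurable_trajectory.
Qed.

Let visits (B : set path) (s : seq 'rV[int]_d) (w : T) : nat :=
  count (fun m => `[< B (translate m (trajectory X w)) >]) s.

Let visitsE B s w :
  ((visits B s w)%:R)%:E = (\sum_(m <- s) (\1_(shifted B m) w)%:E)%E :> \bar R.
Proof.
rewrite sumEFin; congr EFin.
elim: s => [|m s IHs]; rewrite ?big_nil// big_cons -IHs /visits /= natrD indicE.
by congr (_%:R + _); rewrite /in_mem/=.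
Qed.

Let mvisits B s : measurable B ->
  measurable_fun [set: T] (fun w => (visits B s w)%:R : R).
Proof.
move=> mB; apply/measurable_EFinP.
rewrite (_ : _ \o _ =
    fun w => (\sum_(m <- s) (\1_(shifted B m) w)%:E)%E); last first.
  by apply/funext => w; rewrite -visitsE.
apply: emeasurable_sum => m.
by apply/measurable_EFinP/measurable_indic; exact: mshifted.
Qed.

Let expectation_visits (B : set path) (s : seq 'rV[int]_d) : measurable B ->
  (\int[P]_w ((visits B s w)%:R)%:E = (size s)%:R%:E * law X B)%E.
Proof.
move=> mB; under eq_integral do rewrite visitsE.
rewrite ge0_integral_sum//; last first.
  by move=> m; apply/measurable_EFinP/measurable_indic; exact: mshifted.
have intE m : (\int[P]_w (\1_(shifted B m) w)%:E = law X B)%E.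
  by rewrite integral_indic ?setIT//; [exact: stationary|exact: mshifted].
under eq_bigr do rewrite intE.
elim: s => [|m s IHs]; first by rewrite big_nil /= mul0e.
rewrite big_cons IHs /= -natr1 EFinD ge0_muleDl ?lee_fin//.
by rewrite mul1e addeC.
Qed.

(** By stationarity the expected number of visits in a window is its size times the law. No limit in
    [M] is taken: with [M = h] the two windows have sizes [(2h+1)^d] and [(4h+1)^d], whose ratio is
    at most [2^d]. *)
Lemma law_le_of_count (A B : set path) (C h : nat) :
  measurable A -> measurable B ->
  (forall (x : path) M, count (fun m => `[< A (translate m x) >]) (cube d M) <=
     C * count (fun m => `[< B (translate m x) >]) (cube d (M + h)))%N ->
  (law X A <= (C * 2 ^ d)%:R%:E * law X B)%E.
Proof.
move=> mA mB AB.
have size_gt0 : (0 < size (cube d h))%N by rewrite size_cube expn_gt0.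
rewrite -(@lee_pmul2l _ (size (cube d h))%:R%:E) ?lte_fin ?ltr0n//.
rewrite -expectation_visits//.
apply: (@le_trans _ _ (\int[P]_w (C%:R%:E * (visits B (cube d (h + h)) w)%:R%:E)))%E.
  apply: ge0_le_integral => //.
  - apply/measurable_EFinP; exact: mvisits.
  - by apply: emeasurable_funM => //; apply/measurable_EFinP; exact: mvisits.
  - by move=> w _; rewrite -EFinM lee_fin -natrM ler_nat; exact: AB.
rewrite ge0_integralZl_EFin//; last by apply/measurable_EFinP; exact: mvisits.
rewrite expectation_visits// !muleA -!EFinM -!natrM lee_wpmul2r//.
rewrite lee_fin ler_nat mulnCA leq_mul2l; apply/orP; right.
rewrite !size_cube -expnMn.
by case: (d) => // d'; rewrite leq_exp2r//; lia.
Qed.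

End stationary_field.

(** * Critical coverings have probability zero *)

Section random_covering.
Context (d : nat) disp (T : measurableType disp) (R : realType).
Context (P : probability T R) dE (E : measurableType dE).
Context (X : 'rV[int]_d -> {RV P >-> E}) (rad : E -> nat) (K : nat).
Hypothesis stationary :
  forall u : 'rV[int]_d, same_law (fun n : 'rV[int]_d => X (n + u)) X.
Hypothesis mrad : forall j, measurable [set y | (j <= rad y)%N].
Local Notation path := (path_space 'rV[int]_d E).
Implicit Types (x : path) (m n : 'rV[int]_d).

Let measurable_rad (Q : set nat) n : measurable [set x : path | Q (rad (x n))].
Proof.
apply: (measurable_coord _ (B := rad @^-1` Q)).
rewrite (_ : _ @^-1` _ =
    \bigcup_(i in Q) ([set y | (i <= rad y)%N] `\` [set y | (i.+1 <= rad y)%N])).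
  by apply: bigcup_measurable => i _; exact: measurableD.
apply/seteqP; split => y /= => [Qy|[i Qi [/= iy /negP]]].
  by exists (rad y) => //; split => /=; rewrite ?ltnn.
by rewrite -leqNgt => yi; rewrite (_ : rad y = i)//; apply/eqP; rewrite eqn_leq yi.
Qed.

(* Every point lies in cubes of radius [K * rad] with [rad] arbitrarily large,
   but in cubes of radius [rad] only with [rad] bounded. *)
Definition critical : set path :=
  [set x | forall m L, exists n,
     (supn (n - m) <= K * rad (x n))%N /\ (L <= rad (x n))%N] `&`
  [set x | forall m, exists L, forall n,
     (supn (n - m) <= rad (x n))%N -> (rad (x n) < L)%N].

Lemma measurable_critical : measurable critical.
Proof.
apply: measurableI.
  apply: measurable_forall => m; apply: measurable_forall => L.
  apply: measurable_exists => n.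
  exact: (measurable_rad (fun k => (supn (n - m) <= K * k)%N /\ (L <= k)%N)).
apply: measurable_forall => m; apply: measurable_exists => L.
apply: measurable_forall => n.
exact: (measurable_rad (fun k => (supn (n - m) <= k)%N -> (k < L)%N)).
Qed.

Let critical_translate m x : critical x -> critical (translate m x).
Proof.
move=> [cov fin]; split=> [p L|p].
  have [n [pn Ln]] := cov (p + m) L.
  by exists (n - m); rewrite /translate subrK -addrA -opprD (addrC m).
have [L finL] := fin (p + m); exists L => n pn; apply: finL => //.
by rewrite opprD addrACA subrr addr0.
Qed.

Let translateK m x : translate (- m) (translate m x) = x.
Proof. by apply/funext => n; rewrite /translate subrK. Qed.

(** The cap [L1] bounds the distance from the origin to the centre, so that a fixed enlargement of
    the window contains all the cubes used in [count_cover]. *)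
Let big_cover L0 L1 : set path := critical `&` [set x | exists n,
  (supn n <= K * rad (x n))%N /\ (L0 <= rad (x n) <= L1)%N].

Let small_cover L0 : set path := critical `&` [set x | exists n,
  (supn n <= rad (x n))%N /\ (L0 <= rad (x n))%N].

Let measurable_big_cover L0 L1 : measurable (big_cover L0 L1).
Proof.
apply: measurableI; first exact: measurable_critical.
apply: measurable_exists => n.
exact: (measurable_rad (fun k => (supn n <= K * k)%N /\ (L0 <= k <= L1)%N)).
Qed.

Let measurable_small_cover L0 : measurable (small_cover L0).
Proof.
apply: measurableI; first exact: measurable_critical.
apply: measurable_exists => n.
exact: (measurable_rad (fun k => (supn n <= k)%N /\ (L0 <= k)%N)).
Qed.

Let count_cover L0 L1 x M :
  (count (fun m => `[< big_cover L0 L1 (translate m x) >]) (cube d M) <=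
   K.+2 ^ d * count (fun m => `[< small_cover L0 (translate m x) >])
                    (cube d (M + (K * L1 + L1))))%N.
Proof.
have [cx|ncx] := pselect (critical x); last first.
  (* Translating back shows that no translate of a noncritical path is critical, so the left-hand
     count vanishes. *)
  rewrite (@eq_count _ _ pred0) ?count_pred0// => m /=; apply/asboolP => -[c _].
  by apply: ncx; rewrite -(translateK m x); exact: critical_translate.
rewrite -!size_filter.
(* Centres reaching the window lie within [M + K * L1], and their small cubes extend at most [L1]
   further. *)
apply: (@vitali_count _ K (fun n => rad (x n))
  [seq n <- cube d (M + K * L1) | L0 <= rad (x n) <= L1]%N).
- exact/filter_uniq/cube_uniq.
- move=> m; rewrite mem_filter mem_cube.
  move=> /andP[/asboolP[_ [n [nK /andP[L0n nL1]]]] mM].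
  exists (n + m); last by rewrite addrK.
  rewrite mem_filter mem_cube L0n nL1/= (leq_trans (supnD _ _))// addnC leq_add//.
  by rewrite (leq_trans nK)// leq_mul.
- move=> n m; rewrite !mem_filter !mem_cube => /andP[/andP[L0n nL1] nM] nm.
  apply/andP; split.
    apply/asboolP; split; first exact: critical_translate.
    by exists (n - m); rewrite /translate subrK.
  rewrite -(subrK n m) (leq_trans (supnD _ _))// addnC addnA leq_add//.
  by rewrite supnB (leq_trans nm).
Qed.

Lemma law_critical_eq0 : law X critical = 0%E.
Proof.
pose mu := distribution P (trajectory X).
have cover_le L0 L1 :
    (mu (big_cover L0 L1) <= (K.+2 ^ d * 2 ^ d)%:R%:E * mu (small_cover L0))%E.
  exact: (law_le_of_count stationary _ _ (@count_cover L0 L1)).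
have critical_le L0 :
    (mu critical <= (K.+2 ^ d * 2 ^ d)%:R%:E * mu (small_cover L0))%E.
  (* On [critical] the origin is in a large cube of radius parameter at least [L0]; that parameter
     itself serves as [L1]. *)
  have <- : \bigcup_L1 big_cover L0 L1 = critical.
    apply/seteqP; split => [x [L1 _ []]//|x cx].
    have [n []] := cx.1 0 L0; rewrite subr0 => nK L0n.
    by exists (rad (x n)) => //; split => //; exists n; rewrite L0n leqnn.
  apply: cvge_le (nondecreasing_cvg_mu _ _ _).
  - by apply: nearW => L1 /=; exact: cover_le.
  - by [].
  - exact: bigcup_measurable.
  - move=> i j ij; apply/subsetPset => x [cx [n [nK /andP[L0n nL1]]]].
    by split => //; exists n; rewrite L0n (leq_trans nL1).
apply/eqP; rewrite eq_le measure_ge0 andbT.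
(* A path in every [small_cover L] would have the origin in small cubes of unbounded radius, against
   the second half of [critical]. *)
have small0 : \bigcap_L small_cover L = set0.
  rewrite -subset0 => x xL; have [[_ fin] _] := xL 0%N Logic.I.
  have [L finL] := fin 0; have [_ [n [nx Ln]]] := xL L Logic.I.
  by have := finL n; rewrite subr0 => /(_ nx); rewrite ltnNge Ln.
have small_cvg : mu \o small_cover @ \oo --> 0%E.
  rewrite -(measure0 mu) -small0; apply: nonincreasing_cvg_mu => //.
  - by rewrite (le_lt_trans (probability_le1 _ _))// ltry.
  - exact: bigcap_measurable.
  - move=> i j ij; apply/subsetPset => x [cx [n [nx jn]]].
    by split => //; exists n; rewrite (leq_trans ij).
have := cvgeZl (y := (K.+2 ^ d * 2 ^ d)%:R%:E) isT small_cvg.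
rewrite mule0; apply: cvge_ge; apply: nearW => L.
exact: critical_le.
Qed.

End random_covering.

(** * Equivalence of an arbitrary norm with the sup norm *)

Section norm_equivalence.
Context (R : realType) (d : nat) (N : 'rV[R]_d -> R) (hN : is_norm N).

Let normN x : N (- x) = N x.
Proof. by rewrite -scaleN1r (is_norm_scale hN) normrN1 mul1r. Qed.

Let norm0 : N 0 = 0.
Proof. by rewrite -(scale0r 0) (is_norm_scale hN) normr0 mul0r. Qed.

Lemma is_norm_ge0 x : 0 <= N x.
Proof.
have := is_norm_triangle hN x (- x); rewrite subrr norm0 normN -mulr2n.
by rewrite pmulrn_lge0.
Qed.

Lemma is_norm_le_mx_norm : exists2 C, 0 < C & forall x, N x <= C * `|x|.
Proof.
exists (\sum_j N (delta_mx 0 j) + 1) => [|x].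
  by rewrite ltr_wpDl// sumr_ge0// => j _; exact: is_norm_ge0.
rewrite {1}(row_sum_delta x) mulrDl mul1r ler_wpDr// mulr_suml.
elim/big_ind2 : _ => [|a u b v ua vb|j _]; first by rewrite norm0.
  by rewrite (le_trans (is_norm_triangle hN _ _))// lerD.
rewrite (is_norm_scale hN) mulrC ler_wpM2l ?is_norm_ge0//.
rewrite {2}/Num.Def.normr/= mx_normrE.
exact: (le_bigmax _ (fun ij => `|x ij.1 ij.2|) (ord0, j)).
Qed.

Let continuous_is_norm : continuous N.
Proof.
have [C C0 NC] := is_norm_le_mx_norm.
move=> x; apply/(@cvgrPdist_lt _ _ _ (nbhs x) (nbhs_filter x)) => e e0.
near=> y.
have NB u v : N u - N v <= N (u - v).
  by rewrite lerBlDr (le_trans _ (is_norm_triangle hN _ _))// subrK.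
apply: (@le_lt_trans _ _ (C * `|x - y|)).
  rewrite ler_norml (le_trans (NB _ _) (NC _)) andbT lerNl opprB.
  by rewrite (le_trans (NB _ _))// -normN opprB.
rewrite mulrC -ltr_pdivlMr//; near: y.
by have /cvgrPdist_lt := @cvg_id _ (nbhs x); apply; rewrite divr_gt0.
Unshelve. all: by end_near. Qed.

(** The constant is the minimum of [N] on the sup-norm unit sphere, attained by compactness and
    positive by definiteness. The sphere is empty when the space is trivial, which is treated
    apart. *)
Lemma mx_norm_le_is_norm : exists2 c, 0 < c & forall x, c * `|x| <= N x.
Proof.
pose S := [set x : 'rV[R]_d | `|x| = 1].
have [S0|/set0P/negP/negPn/eqP S0] := pselect (S !=set0); last first.
  exists 1 => // x; suff -> : x = 0 by rewrite normr0 norm0 mulr0.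
  apply: contrapT => /eqP x0; suff : S (`|x|^-1 *: x) by rewrite S0.
  by rewrite /S/= normrZ normfV normr_id mulVf// normr_eq0.
have cS : compact S.
  apply: bounded_closed_compact.
    exists 1; split => // M M1 x /= ->; exact: ltW.
  rewrite (_ : S = (fun x => `|x|) @^-1` [set 1])//.
  by apply: closed_comp => [x _|]; [exact: norm_continuous|exact: closed_eq].
have [|u uS umin] := EVT_min_rV S0 cS (f := N).
  exact: continuous_subspaceT.
have Nu : 0 < N u.
  rewrite lt_neqAle is_norm_ge0 andbT eq_sym; apply/eqP => /(is_norm_eq0 hN) u0.
  by move: uS; rewrite inE /S/= u0 normr0 => /esym/eqP; rewrite oner_eq0.
exists (N u) => // x; have [->|x0] := eqVneq x 0.
  by rewrite normr0 mulr0 is_norm_ge0.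
rewrite -ler_pdivlMr ?normr_gt0// mulrC -[`|x|^-1]ger0_norm ?invr_ge0//.
rewrite -(is_norm_scale hN); apply: umin; rewrite inE /S/=.
by rewrite normrZ normfV normr_id mulVf// normr_eq0.
Qed.

Lemma mx_norm_intr (n : 'rV[int]_d) : `|map_mx intr n : 'rV[R]_d| = (supn n)%:R.
Proof.
rewrite [LHS]mx_normrE; apply/eqP; rewrite eq_le; apply/andP; split.
  apply/bigmax_leP; split => // -[i j] _ /=.
  by rewrite mxE ord1 -intr_norm -abszE ler_nat supn_coord.
rewrite /supn; elim/big_ind : _ => [|a b ha hb|j _].
- exact: bigmax_ge_id.
- by rewrite /maxn; case: ifP.
- rewrite (le_trans _ (le_bigmax _ _ (ord0, j)))//=.
  by rewrite mxE -intr_norm -abszE.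
Qed.
End norm_equivalence.

Lemma lattice_norm_equiv (R : realType) (d : nat) (N : 'rV[R]_d -> R) :
  is_norm N -> exists c C : R, [/\ 0 < c, 0 < C & forall n : 'rV[int]_d,
    c * (supn n)%:R <= lattice_norm N n <= C * (supn n)%:R].
Proof.
move=> hN; have [C C0 NC] := is_norm_le_mx_norm hN.
have [c c0 cN] := mx_norm_le_is_norm hN.
by exists c, C; split => // n; rewrite -mx_norm_intr cN NC.
Qed.

(** * Linear growth of the field produces critical coverings *)

Lemma measurable_truncn_div (R : realType) (b : R) (j : nat) :
  0 < b -> measurable [set y : R | (j <= Num.truncn (y / b))%N].
Proof.
move=> b0; case: j => [|j].
  by rewrite (_ : mkset _ = setT)//; apply/seteqP; split.
rewrite (_ : mkset _ = `[j.+1%:R * b, +oo[%classic).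
  exact: measurable_itv.
by apply/seteqP; split => y /=; rewrite in_itv/= andbT truncn_gt_nat ler_pdivlMr.
Qed.

(** With [B >= 2bC], far centres have radius at most [supn n / 2], so their small cubes miss any
    given point eventually. With [K >= 4B/(ac)], a centre where [x n > a * N n] has
    [K * rho n >= 2 * supn n], enough to reach any [m] with [supn m <= supn n]. The scale [B] is an
    integer so that only countably many events arise. *)
Lemma critical_of_linear_growth (R : realType) (d : nat) (N : 'rV[R]_d -> R)
    (x : 'rV[int]_d -> R) (a b r0 : R) :
  is_norm N -> 0 < a -> 0 < b ->
  (forall r, exists2 n, r < lattice_norm N n & a * lattice_norm N n < x n) ->
  (forall n, r0 < lattice_norm N n -> x n < b * lattice_norm N n) ->
  exists j K : nat, critical (fun y : R => Num.truncn (y / j.+1%:R)) K x.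
Proof.
move=> hN a0 b0 xa xb; have [c [C [c0 C0 NcC]]] := lattice_norm_equiv hN.
pose j := Num.truncn (2 * b * C); pose B : R := j.+1%:R.
have Bge : 2 * b * C <= B by rewrite ltW// truncnS_gt.
have B0 : 0 < B by rewrite ltr0n.
pose K := (Num.truncn (4 * B / (a * c))).+1.
have Kge : 4 * B <= K%:R * (a * c).
  by rewrite -ler_pdivrMr ?mulr_gt0// ltW// truncnS_gt.
exists j, K; rewrite -/B; split => [m L|m].
  (* The first term of the threshold forces a radius of at least [L + 1], the second forces
     [supn m <= supn n]. *)
  have [n nlarge anx] := xa (L.+1%:R * B / a + C * (supn m)%:R).
  have /andP[cn nC] := NcC n.
  set t := Num.truncn (x n / B); exists n.
  have Lt : (L.+1 <= t)%N.
    rewrite truncn_gt_nat ler_pdivlMr// (le_trans _ (ltW anx))//.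
    rewrite [leRHS]mulrC -ler_pdivrMr// (le_trans _ (ltW nlarge))// lerDl mulr_ge0//.
    exact: ltW.
  split; last exact: ltnW.
  have mn : (supn m <= supn n)%N.
    rewrite -(ler_nat R) -(ler_pM2l C0) (le_trans _ nC)//.
    by apply: le_trans (ltW nlarge); rewrite lerDr divr_ge0// ?mulr_ge0// ltW.
  rewrite (leq_trans (supnD _ _))// supnN.
  suff : (2 * supn n <= K * t)%N by lia.
  have xt : x n < t.+1%:R * B by rewrite -ltr_pdivrMr// truncnS_gt.
  rewrite -(ler_nat R) !natrM -(ler_pM2r B0).
  have acx : a * c * (supn n)%:R <= t.+1%:R * B.
    rewrite ltW// (le_lt_trans _ xt)// (le_trans _ (ltW anx))//.
    by rewrite -mulrA ler_wpM2l// ltW.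
  (* This needs [t >= 1], hence [L.+1] rather than [L] above. *)
  have t2 : t.+1%:R <= 2 * t%:R :> R by rewrite -natrM ler_nat; lia.
  have : 4 * B * (supn n)%:R <= K%:R * (t.+1%:R * B).
    rewrite (le_trans (ler_wpM2r _ Kge))// -mulrA ler_wpM2l//.
  have : K%:R * (t.+1%:R * B) <= K%:R * (2 * t%:R * B).
    by rewrite ler_wpM2l// ler_wpM2r// ltW.
  lra.
(* Centres with norm at most [r0] lie in a finite cube, which gives the maximum. For the others
   [2 * t <= supn n <= t + supn m], so [t <= supn m]. *)
exists (\max_(n <- cube d (Num.truncn (r0 / c))) Num.truncn (x n / B) + supn m).+1%N.
move=> n; set t := Num.truncn (x n / B) => nt; rewrite ltnS.
have /andP[cn nC] := NcC n.
have [r0n|nr0] := ltP r0 (lattice_norm N n); last first.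
  rewrite (leq_trans _ (leq_addr _ _))//.
  rewrite (leq_bigmax_seq (F := fun n => Num.truncn (x n / B)))// mem_cube.
  have r0c : (supn n)%:R <= r0 / c by rewrite ler_pdivlMr// mulrC (le_trans cn).
  by rewrite truncn_ge_nat// (le_trans _ r0c).
rewrite (leq_trans _ (leq_addl _ _))//.
have t2 : (2 * t <= supn n)%N.
  (* A negative quotient truncates to [0]. *)
  have [x0|x0] := leP 0 (x n / B); last first.
    suff -> : t = 0%N by rewrite muln0.
    by apply/truncn0Pn; rewrite -ltNge (lt_trans x0).
  have : t%:R <= x n / B by rewrite truncn_le.
  rewrite ler_pdivlMr// => tx.
  rewrite -(ler_nat R) natrM -(ler_pM2r B0).
  have := xb _ r0n; have : b * lattice_norm N n <= b * (C * (supn n)%:R).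
    by rewrite ler_wpM2l// ltW.
  have : 2 * b * C * (supn n)%:R <= B * (supn n)%:R by rewrite ler_wpM2r.
  lra.
have : (supn n <= supn (n - m) + supn m)%N by rewrite -{1}(subrK m n) supnD.
lia.
Qed.

(** * The limsup is almost surely nonnegative *)

Section limsup_nonnegative.
Context (R : realType) (d : nat) (hd : (0 < d)%N).
Context (N : 'rV[R]_d -> R) (hN : is_norm N).
Context disp (T : measurableType disp) (P : probability T R).
Context (X : 'rV[int]_d -> {RV P >-> R}) (hX : translation_invariant X).

(* [X n] has the law of [X 0], so [X n / N n] tends to [0] in probability. *)
Lemma negligible_linear_decay (e r : R) : 0 < e ->
  P.-negligible [set w | forall n, r < lattice_norm N n ->
                                   X n w <= - e * lattice_norm N n].
Proof.
move=> e0; have [c [C [c0 C0 NcC]]] := lattice_norm_equiv hN.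
have mle n (y : R) : measurable [set w | X n w <= y].
  rewrite (_ : mkset _ = X n @^-1` `]-oo, y]%classic).
    by rewrite -[_ @^-1` _]setTI; exact: measurable_funPT.
  by apply/seteqP; split => w /=; rewrite in_itv.
set G := mkset _.
have mG : measurable G.
  apply: measurable_forall => n.
  have [rn|nr] := ltP r (lattice_norm N n).
    rewrite [X in measurable X](_ : _ = [set w | X n w <= - e * lattice_norm N n])//.
    by apply/seteqP; split => w /=; [apply|].
  rewrite [X in measurable X](_ : _ = setT)//; by apply/seteqP; split.
apply/negligibleP => //; apply/eqP; rewrite eq_le measure_ge0 andbT.
pose D k := [set w | X 0 w <= - e * (c * k%:R)].
have D0 : \bigcap_k D k = set0.
  rewrite -subset0 => w Dw; pose k := (Num.truncn (- X 0 w / (e * c))).+1.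
  have := truncnS_gt (- X 0 w / (e * c)); rewrite -/k ltr_pdivrMr ?mulr_gt0//.
  by have := Dw k Logic.I; rewrite /D/=; lra.
have D_cvg : P \o D @ \oo --> 0%E.
  rewrite -(measure0 P) -D0; apply: nonincreasing_cvg_mu => //.
  - by rewrite (le_lt_trans (probability_le1 _ (mle _ _)))// ltry.
  - by move=> k; exact: mle.
  - by apply: bigcapT_measurable => k; exact: mle.
  - move=> i k ik; apply/subsetPset => w /= /le_trans; apply.
    by rewrite ler_nM2l ?oppr_lt0// ler_pM2l// ler_nat.
(* For large [k], testing [G] at the constant vector [n] of value [k] gives [P G <= P (D k)], since
   [X n] has the law of [X 0] and [N n >= c * k]. That [supn n = k] uses [hd]. *)
apply: (cvge_ge _ D_cvg); exists (Num.truncn (r / c)).+1 => // k /= rk.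
pose n : 'rV[int]_d := const_mx k%:Z.
have kn : supn n = k.
  apply/eqP; rewrite eqn_leq; apply/andP; split.
    by apply/supn_leP => i; rewrite mxE.
  by have := supn_coord n (Ordinal hd); rewrite mxE.
have /andP[cn _] := NcC n.
have rn : r < lattice_norm N n.
  rewrite (lt_le_trans _ cn)// kn mulrC -ltr_pdivrMr//.
  by rewrite (lt_le_trans (truncnS_gt _))// ler_nat.
have mA : measurable [set x : path_space 'rV[int]_d R | x 0 <= - e * (c * k%:R)].
  rewrite (_ : mkset _ =
    [set x : path_space 'rV[int]_d R | `]-oo, - e * (c * k%:R)]%classic (x 0)]).
    exact: measurable_coord.
  by apply/seteqP; split => x /=; rewrite in_itv.
have := hX n mA; rewrite /law /distribution /pushforward /= => <-.
apply: le_measure; rewrite ?inE//; first exact: (mle (0 + n)).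
move=> w Gw; rewrite /trajectory /= add0r (le_trans (Gw _ rn))//.
by rewrite ler_nM2l ?oppr_lt0// -kn.
Qed.

End limsup_nonnegative.

(** * Translating values of the limsup into countably many events *)

Lemma limsup_norm_lt0 (R : realType) (d : nat) (N : 'rV[R]_d -> R)
    (x : 'rV[int]_d -> R) :
  (limsup_norm N (fun n => (x n / lattice_norm N n)%:E) < 0)%E ->
  exists j i : nat, forall n, i%:R < lattice_norm N n ->
    x n <= - j.+1%:R^-1 * lattice_norm N n.
Proof.
move=> /ereal_inf_lt[_ [V [r _ rV] <-] supV].
have [j supj] : exists j : nat,
    (ereal_sup [set (x n / lattice_norm N n)%:E | n in V] <= (- j.+1%:R^-1)%:E)%E.
  move: supV; case: (ereal_sup _) => [s|//|_]; last by exists 0%N; rewrite leNye.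
  rewrite lte_fin -oppr_gt0 => /ltr_add_invr[j]; rewrite add0r => js.
  by exists j; rewrite lee_fin lerNr ltW.
exists j, (Num.truncn r).+1 => n rn.
rewrite -ler_pdivrMr; last by rewrite (le_lt_trans _ rn).
rewrite -lee_fin (le_trans _ supj)//; apply: ereal_sup_ubound.
by exists n => //; apply: rV; rewrite /= (lt_trans _ rn)// truncnS_gt.
Qed.

Lemma limsup_norm_pos_finite (R : realType) (d : nat) (N : 'rV[R]_d -> R)
    (x : 'rV[int]_d -> R) (s : R) : 0 < s ->
  limsup_norm N (fun n => (x n / lattice_norm N n)%:E) = s%:E ->
  exists a b r0 : R, [/\ 0 < a, 0 < b,
    forall r, exists2 n, r < lattice_norm N n & a * lattice_norm N n < x n &
    forall n, r0 < lattice_norm N n -> x n < b * lattice_norm N n].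
Proof.
set l := limsup_norm _ _ => s0 El.
have : (l < (s + 1)%:E)%E by rewrite El lte_fin ltrDl.
move=> /ereal_inf_lt[_ [V [r0 _ rV] <-] supV].
(* Any levels on either side of [s] would do; the maximum with [0] makes the norm positive, so that
   the quotient can be cleared. *)
exists (s / 2), (s + 1), (Num.max r0 0); split.
- by rewrite divr_gt0.
- by rewrite addr_gt0.
- move=> r; pose W := [set n | Num.max r 0 < lattice_norm N n].
  have : ((s / 2)%:E < ereal_sup [set (x n / lattice_norm N n)%:E | n in W])%E.
    apply: (@lt_le_trans _ _ l); first by rewrite El lte_fin ltr_pdivrMr//; lra.
    by apply: ereal_inf_lbound; exists W => //; exists (Num.max r 0).
  move=> /ereal_sup_gt[_ [n Wn <-]]; move: Wn; rewrite /W/= gt_max => /andP[rn n0].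
  by rewrite lte_fin ltr_pdivlMr//; exists n.
- move=> n; rewrite gt_max => /andP[rn n0].
  rewrite -ltr_pdivrMr// -lte_fin (le_lt_trans _ supV)//.
  by apply: ereal_sup_ubound; exists n => //; exact: rV.
Qed.

Theorem theorem4 (R : realType) (d : nat) (hd : (1 <= d)%N)
    (N : 'rV[R]_d -> R) (hN : is_norm N)
    (disp : measure_display) (T : measurableType disp) (P : probability T R)
    (X : 'rV[int]_d -> {RV P >-> R}) (hX : translation_invariant X) :
  {ae P, forall w : T,
    limsup_norm N (fun n : 'rV[int]_d => (X n w / lattice_norm N n)%:E)
      \in [set 0%E; +oo%E]}.
Proof.
pose decay j i := [set w | forall n, i%:R < lattice_norm N n ->
  X n w <= - j.+1%:R^-1 * lattice_norm N n].
pose crit j K := trajectory X @^-1`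
  critical (fun y : R => Num.truncn (y / j.+1%:R)) K.
(* A negative limsup, [-oo] included, falls in some [decay j i], and a value in []0, +oo[] in some
   [crit j K]; a countable union of negligible sets is negligible. *)
apply: (@negligibleS _ _ _ _
  ((\bigcup_j \bigcup_i decay j i) `|` (\bigcup_j \bigcup_K crit j K))).
  move=> w /= nlim; set l := limsup_norm N _ in nlim.
  have [l0|l0|l0] := ltgtP l 0%E; last by case: nlim; rewrite l0 inE; left.
  - left; have [j [i ji]] := limsup_norm_lt0 l0.
    by exists j => //; exists i.
  - right; move: nlim l0; rewrite /l; case El : (limsup_norm N _) => [s| |]//.
      rewrite lte_fin => _ s0.
      have [a [b [r0 [a0 b0 xa xb]]]] := limsup_norm_pos_finite s0 El.
      have [j [K jK]] := critical_of_linear_growth hN a0 b0 xa xb.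
      by exists j => //; exists K.
    by case; rewrite inE; right.
apply: negligibleU; apply: negligible_bigcup => j; apply: negligible_bigcup => i.
  by apply: negligible_linear_decay; rewrite ?invr_gt0.
have mrad k := @measurable_truncn_div R j.+1%:R k (ltr0Sn _ _).
apply/negligibleP; last exact: (law_critical_eq0 _ hX mrad).
rewrite -[crit _ _]setTI; apply: measurable_trajectory => //.
exact: measurable_critical.
Qed.
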